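(* For integers $s\ge 3$ and $n\ge 2$, we have $f(s;n)\le 2^{5^s s!(\log n)^{s-2}}$.
   Context: For a coloring $\chi$ of the pairs of $[N]=\{1,\dots,N\}$ with integer colors, a triple $u<v<w$ is non-increasing if either $\chi(u,v)=\chi(u,w)\ge\chi(v,w)$ or $\chi(u,v)\ge\chi(v,w)=\chi(u,w)$; a set $S\subset[N]$ is non-increasing if all its triples are. $f(s;q)$ denotes the minimum $N$ such that for every coloring of the pairs of $[N]$ with at most $q$ colors $\kappa_1<\dots<\kappa_q$ (integers), there is a set $S\subset[N]$ of size $s$ that is non-increasing. Logarithms are base $2$. *)

(* Defs.v *)
From mathcomp Require Import all_boot all_order all_algebra.
From mathcomp Require Import reals exp.

Set Implicit Arguments.
Unset Strict Implicit.
Unset Printing Implicit Defensive.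

Import Order.TTheory GRing.Theory Num.Theory.
Local Open Scope ring_scope.

(* The vertex set [N] = {1, ..., N} is represented by the ordinals
   'I_N = {0, ..., N - 1}.  A coloring of the pairs of [N] is a function
   chi : 'I_N -> 'I_N -> int of which only the values chi u v with u < v are
   ever used. *)

Definition noninc_triple (N : nat) (chi : 'I_N -> 'I_N -> int)
    (u v w : 'I_N) : Prop :=
  (chi u v = chi u w /\ chi u w >= chi v w) \/
  (chi u v >= chi v w /\ chi v w = chi u w).

Definition noninc_set (N : nat) (chi : 'I_N -> 'I_N -> int)
    (S : {set 'I_N}) : Prop :=
  forall u v w : 'I_N, u \in S -> v \in S -> w \in S ->
    (u < v)%N -> (v < w)%N -> noninc_triple chi u v w.

(* All colors lie in {kappa_1 < ... < kappa_q}; not all of them need occur. *)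
Definition colored_with (N q : nat) (kappa : 'I_q -> int)
    (chi : 'I_N -> 'I_N -> int) : Prop :=
  (forall i j : 'I_q, (i < j)%N -> kappa i < kappa j) /\
  (forall u v : 'I_N, (u < v)%N -> exists i : 'I_q, chi u v = kappa i).

Definition forces_noninc (s q N : nat) : Prop :=
  forall (kappa : 'I_q -> int) (chi : 'I_N -> 'I_N -> int),
    colored_with kappa chi ->
    exists S : {set 'I_N}, #|S| = s /\ noninc_set chi S.

(* is_f s q N means "f(s; q) = N": N is the minimum of the set of those M for
   which the forcing property holds.  In particular it asserts that this set
   is nonempty, and it determines N uniquely. *)
Definition is_f (s q N : nat) : Prop :=
  forces_noninc s q N /\ (forall M : nat, forces_noninc s q M -> (N <= M)%N).

Definition log2 (R : realType) (x : R) : R := ln x / ln 2.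

(* Main.v *)
(* The bound obtained is polynomial in [n], of exponent depending on [s] only.
   A vertex [u] added in front of a non-increasing set preserves the property
   if [u] sends one color [k] to the whole set and all colors of the set are at
   most [k]; dually for a vertex added at the end.  Assume that [X] has no
   non-increasing set of more than [r + 1] vertices with colors in a palette
   [P], and compare the colors of [P] with a threshold [m].  Either some [u]
   has many forward neighbors of color at least [m] in [P], and these split
   into [n] classes (by their color to [u]) in which the colors of [P] up to
   [m] admit only non-increasing sets of at most [r] vertices, or the dual
   holds.  A binary search on [m], each step of which loses only a constant
   factor of [X], ends with a threshold for which both statements hold;
   choosing one class on each side loses a factor [n ^ 2] and replaces [P]
   by two palettes with parameter [r - 1].  Starting from all colors with
   [r = s - 2], at most [2 ^ (s - 2)] palettes are ever present at once, and
   once all parameters are [0] no pair of vertices is left. *)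
Require Import Defs.
From HB Require Import structures.
From mathcomp Require Import all_boot all_order all_algebra zify.
From mathcomp Require Import boolp reals exp.

Set Implicit Arguments.
Unset Strict Implicit.
Unset Printing Implicit Defensive.

Import Order.TTheory GRing.Theory Num.Theory.
Local Open Scope nat_scope.

Section BinarySearch.

Variables (N n : nat) (c : 'I_N -> 'I_N -> 'I_n).
Implicit Types (P Q : {set 'I_n}) (S X Y : {set 'I_N}) (u v w : 'I_N).

(** * Palettes and caps on non-increasing sets *)

Definition nonincreasing (S : {set 'I_N}) : Prop :=
  forall u v w : 'I_N, u \in S -> v \in S -> w \in S -> u < v -> v < w ->
    (c u v = c u w /\ c v w <= c u w) \/ (c v w <= c u v /\ c v w = c u w).

Definition colors_in (P : {set 'I_n}) (S : {set 'I_N}) : Prop :=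
  forall u v : 'I_N, u \in S -> v \in S -> u < v -> c u v \in P.

(** The bound is [r.+1] so that [r = 0] means that no pair of [X] has its color in [P]. *)
Definition capped (P : {set 'I_n}) (r : nat) (X : {set 'I_N}) : Prop :=
  forall S : {set 'I_N}, S \subset X -> nonincreasing S -> colors_in P S ->
    #|S| <= r.+1.

Definition colors_lt (P : {set 'I_n}) (a : nat) := [set k in P | k < a].
Definition colors_ge (P : {set 'I_n}) (a : nat) := [set k in P | a <= k].

Lemma capped_subset P Q r X Y :
  P \subset Q -> Y \subset X -> capped Q r X -> capped P r Y.
Proof.
move=> PQ YX capX S SY incS PS; apply: capX => //; first exact: subset_trans YX.
by move=> u v uS vS uv; apply: (subsetP PQ); apply: PS.
Qed.


Lemma capped_no_color r X : capped set0 r X.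
Proof.
move=> S _ _ S0; apply: leq_trans (ltn0Sn r).
rewrite leqNgt; apply/negP => /card_gt1P[x [y [xS yS]]].
rewrite -val_eqE neq_ltn => /orP[] xy.
  by have := S0 _ _ xS yS xy; rewrite inE.
by have := S0 _ _ yS xS xy; rewrite inE.
Qed.

Lemma capped0_no_pair P X u v :
  capped P 0 X -> u \in X -> v \in X -> u < v -> c u v \notin P.
Proof.
move=> capX uX vX uv; apply/negP => Puv.
have neq : u != v by rewrite -val_eqE neq_ltn uv.
suff: #|[set u; v]| <= 1 by rewrite cards2 neq.
apply: capX.
- by apply/subsetP => x; rewrite !inE => /orP[] /eqP->.
- move=> x y z; rewrite !inE => /orP[] /eqP-> /orP[] /eqP-> /orP[] /eqP-> *;
    exfalso; lia.
- move=> x y; rewrite !inE => /orP[] /eqP-> /orP[] /eqP-> // *; exfalso; lia.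
Qed.

(** Adding [u] in front costs one unit of the cap; the color [m] itself is allowed both for [k] and
    inside the set. *)
Lemma capped_after P r X u (k : 'I_n) m :
  u \in X -> k \in P -> m <= k -> capped P r.+1 X ->
  capped (colors_lt P m.+1) r [set v in X | (u < v) && (c u v == k)].
Proof.
move=> uX kP mk capX S /subsetP SY incS PS.
have uS v : v \in S -> [/\ v \in X, u < v & c u v = k].
  by move=> /SY; rewrite inE => /andP[vX /andP[uv /eqP]].
have nuS : u \notin S by apply/negP => /uS [_]; rewrite ltnn.
suff : #|u |: S| <= r.+2 by rewrite cardsU1 nuS.
apply: capX.
- by apply/subsetP => x; rewrite !inE => /orP[/eqP-> //|/uS[]].
- move=> x y z; rewrite !in_setU1.
  case/orP=> [/eqP->|xS] /orP[/eqP->|yS] /orP[/eqP->|zS]; rewrite ?ltnn //.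
  + by have [_ ? _] := uS _ yS => *; exfalso; lia.
  + move=> _ yz; have [_ _ ->] := uS _ yS; have [_ _ ->] := uS _ zS.
    left; split=> //; have := PS _ _ yS zS yz; rewrite inE => /andP[_]; lia.
  + by have [_ ? _] := uS _ xS => *; exfalso; lia.
  + by have [_ ? _] := uS _ xS => *; exfalso; lia.
  + exact: incS.
- move=> x y; rewrite !in_setU1.
  case/orP=> [/eqP->|xS] /orP[/eqP->|yS]; rewrite ?ltnn //.
  + by have [_ _ ->] := uS _ yS.
  + by have [_ ? _] := uS _ xS => *; exfalso; lia.
  + by move=> xy; have := PS _ _ xS yS xy; rewrite inE => /andP[].
Qed.

Lemma capped_before P r X w (k : 'I_n) m :
  w \in X -> k \in P -> k <= m -> capped P r.+1 X ->
  capped (colors_ge P m) r [set v in X | (v < w) && (c v w == k)].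
Proof.
move=> wX kP km capX S /subsetP SY incS PS.
have wS v : v \in S -> [/\ v \in X, v < w & c v w = k].
  by move=> /SY; rewrite inE => /andP[vX /andP[vw /eqP]].
have nwS : w \notin S by apply/negP => /wS [_]; rewrite ltnn.
suff : #|w |: S| <= r.+2 by rewrite cardsU1 nwS.
apply: capX.
- by apply/subsetP => x; rewrite !inE => /orP[/eqP-> //|/wS[]].
- move=> x y z; rewrite !in_setU1.
  case/orP=> [/eqP->|xS] /orP[/eqP->|yS] /orP[/eqP->|zS]; rewrite ?ltnn //.
  + by have [_ ? _] := wS _ yS => *; exfalso; lia.
  + by have [_ ? _] := wS _ yS => *; exfalso; lia.
  + by have [_ ? _] := wS _ zS => *; exfalso; lia.
  + move=> xy _; have [_ _ ->] := wS _ xS; have [_ _ ->] := wS _ yS.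
    right; split=> //; have := PS _ _ xS yS xy; rewrite inE => /andP[_]; lia.
  + exact: incS.
- move=> x y; rewrite !in_setU1.
  case/orP=> [/eqP->|xS] /orP[/eqP->|yS]; rewrite ?ltnn //.
  + by have [_ ? _] := wS _ yS => *; exfalso; lia.
  + by have [_ _ ->] := wS _ xS.
  + by move=> xy; have := PS _ _ xS yS xy; rewrite inE => /andP[].
Qed.

(** * States of the binary search and its two moves *)

Definition class_capped (P : {set 'I_n}) (r : nat) (X : {set 'I_N}) : Prop :=
  exists f : 'I_N -> 'I_n, forall j, capped P r [set x in X | f x == j].

(* A palette with a binary search in progress: the threshold still to be
   found lies between [base] and [base + 2 ^ fuel - 1]. *)
Record task := Task { palette : {set 'I_n}; cap : nat; fuel : nat; base : nat }.

Definition pack (i : task) := (palette i, cap i, fuel i, base i).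
Definition unpack x := let: (P, r, t, a) := x in Task P r t a.
Lemma packK : cancel pack unpack. Proof. by case. Qed.
HB.instance Definition _ := Equality.copy task (can_type packK).

(** With positive fuel, the lower half of the range ends at [mid i] and the upper half starts one
    above it. *)
Definition mid (i : task) := base i + (2 ^ (fuel i).-1).-1.

(** The class bounds hold at the two ends of the range; without fuel the ends coincide and the two
    palettes partition [palette i]. *)
Definition valid (X : {set 'I_N}) (i : task) : Prop :=
  [/\ capped (palette i) (cap i) X,
      class_capped (colors_lt (palette i) (base i)) (cap i).-1 X &
      class_capped (colors_ge (palette i) (base i + (2 ^ fuel i).-1))
        (cap i).-1 X].

Lemma class_capped_subset P Q r X Y :
  P \subset Q -> Y \subset X -> class_capped Q r X -> class_capped P r Y.
Proof.
move=> PQ YX [f fX]; exists f => j; apply: capped_subset (fX j) => //.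
by apply/subsetP => x; rewrite !inE => /andP[/(subsetP YX)-> ->].
Qed.

Lemma valid_subset X Y i : Y \subset X -> valid X i -> valid Y i.
Proof.
move=> YX [? ? ?]; split.
- by apply: capped_subset YX _.
- by apply: class_capped_subset YX _.
- by apply: class_capped_subset YX _.
Qed.

Definition after (X : {set 'I_N}) (i : task) (u : 'I_N) : {set 'I_N} :=
  [set v in X | [&& u < v, c u v \in palette i & mid i <= c u v]].

Definition before (X : {set 'I_N}) (i : task) (w : 'I_N) : {set 'I_N} :=
  [set v in X | [&& v < w, c v w \in palette i & c v w <= mid i]].

Lemma after_subset X i u : after X i u \subset X.
Proof. by apply/subsetP => v; rewrite inE => /andP[]. Qed.

Lemma before_subset X i u : before X i u \subset X.
Proof. by apply/subsetP => v; rewrite inE => /andP[]. Qed.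

(** The classes of [c u] give the bound at the new lower end [mid i + 1]; the upper end does not
    move. *)
Lemma valid_after X P r t a u : let i := Task P r.+1 t.+1 a in
  u \in X -> valid X i -> valid (after X i u) (Task P r.+1 t (a + 2 ^ t)).
Proof.
move=> i uX [capX _ capge].
have t0 : 0 < 2 ^ t by rewrite expn_gt0.
split => /=.
- exact: capped_subset (after_subset _ _ _) capX.
(* A color outside [P] or below [mid i] has an empty class. *)
- exists (c u) => k; case kPm : ((k \in P) && (mid i <= k)); last first.
    move=> S /subsetP SY _ _; rewrite (_ : S = set0) ?cards0 //.
    apply/setP => v; rewrite [RHS]inE; apply/negP => /SY.
    rewrite !inE => /andP[/andP[_ /and3P[_ h1 h2]] /eqP cuv].
    by rewrite -cuv h1 h2 in kPm.
  case/andP: kPm => kP mk.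
  have := capped_after uX kP mk capX; apply: capped_subset.
    by apply/subsetP => j; rewrite !inE /mid /= => /andP[-> /=]; lia.
  by apply/subsetP => v; rewrite !inE => /andP[/andP[-> /and3P[-> _ _]] ->].
- apply: class_capped_subset capge; last exact: after_subset.
  by apply/subsetP => j; rewrite !inE /= expnS => /andP[-> /=]; lia.
Qed.

(** The colors to [w] give the bound at the new upper end [mid i]; the lower end does not move. *)
Lemma valid_before X P r t a w : let i := Task P r.+1 t.+1 a in
  w \in X -> valid X i -> valid (before X i w) (Task P r.+1 t a).
Proof.
move=> i wX [capX caplt _]; split => /=.
- exact: capped_subset (before_subset _ _ _) capX.
- exact: class_capped_subset (before_subset _ _ _) caplt.
- exists (c^~ w) => k; case kPm : ((k \in P) && (k <= mid i)); last first.
    move=> S /subsetP SY _ _; rewrite (_ : S = set0) ?cards0 //.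
    apply/setP => v; rewrite [RHS]inE; apply/negP => /SY.
    rewrite !inE => /andP[/andP[_ /and3P[_ h1 h2]] /eqP cuv].
    by rewrite -cuv h1 h2 in kPm.
  case/andP: kPm => kP mk.
  have := capped_before wX kP mk capX; apply: capped_subset => //.
  by apply/subsetP => v; rewrite !inE => /andP[/andP[-> /and3P[-> _ _]] ->].
Qed.

(** * Double counting of pairs *)

Lemma card_pairs X :
  #|X| * #|X|.-1 = (\sum_(u in X) \sum_(v in X) (u < v)).*2.
Proof.
have -> : #|X| * #|X|.-1 = \sum_(u in X) \sum_(v in X) ((u < v) + (v < u)).
  rewrite -sum_nat_const; apply: eq_bigr => u uX.
  rewrite (cardsD1 u X) uX add1n /= (bigD1 u) //= ltnn add0n -sum1_card.
  rewrite [LHS](eq_bigl (fun v => (v \in X) && (v != u))); last first.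
    by move=> v; rewrite !inE andbC.
  by apply: eq_bigr => v /andP[_]; rewrite -val_eqE /=; lia.
under eq_bigr do rewrite big_split /=.
by rewrite big_split /= [X in _ + X]exchange_big addnn.
Qed.

(** A pair with color in [palette i] is seen from its first vertex if the color is at least [mid i],
    and from its second if it is at most [mid i]. *)
Lemma card_pairs_le X (st : seq task) :
  (forall u v, u \in X -> v \in X -> u < v ->
     has (fun i => c u v \in palette i) st) ->
  \sum_(u in X) \sum_(v in X) (u < v) <=
    \sum_(i <- st) \sum_(u in X) (#|after X i u| + #|before X i u|).
Proof.
move=> cov.
rewrite [leqRHS](eq_bigr (fun i => \sum_(u in X) \sum_(v in X)
   ((v \in after X i u) + (u \in before X i v)))); last first.
  move=> i _; under [RHS]eq_bigr do rewrite big_split /=.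
  rewrite !big_split /=; congr (_ + _).
    apply: eq_bigr => u uX; rewrite -sum1_card big_mkcond [RHS]big_mkcond /=.
    by apply: eq_bigr => v _; rewrite inE; case: (v \in X) => //=; case: ifP.
  rewrite [RHS]exchange_big /=.
  apply: eq_bigr => u uX; rewrite -sum1_card big_mkcond [RHS]big_mkcond /=.
  by apply: eq_bigr => v _; rewrite inE; case: (v \in X) => //=; case: ifP.
rewrite [leqRHS]exchange_big /=; apply: leq_sum => u uX.
rewrite [leqRHS]exchange_big /=; apply: leq_sum => v vX.
case: ltnP => // uv; have /hasP[i ist Pi] := cov _ _ uX vX uv.
rewrite (big_rem i) //= !inE uX vX uv Pi /=; lia.
Qed.

(* Each step of the binary search costs the factor [4 * K + 1], and
   splitting a palette in two costs [n ^ 2], one choice of a class for each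
   half; [T] is the fuel that a new task receives. *)
Fixpoint cost K T r t : nat :=
  if r is r'.+1 then (4 * K).+1 ^ t * n ^ 2 * cost K T r' T ^ 2 else 1.

Lemma cost_gt0 K T r t : 0 < n -> 0 < cost K T r t.
Proof.
by move=> n0; elim: r t => //= r IH t; rewrite !muln_gt0 !expn_gt0 n0 IH.
Qed.

(** * The size bound, by induction on the product of costs *)

Lemma card_fibers X (B : nat) (f g : 'I_N -> 'I_n) :
  (forall j k, #|[set x in X | (f x == j) && (g x == k)]| <= B) ->
  #|X| <= n ^ 2 * B.
Proof.
move=> le_B; rewrite -sum1_card.
rewrite (partition_big (fun x => (f x, g x)) predT) //=.
have -> : n ^ 2 = #|{: 'I_n * 'I_n}| by rewrite card_prod card_ord mulnn.
rewrite -sum_nat_const; apply: leq_sum => -[j k] _; apply: leq_trans (le_B j k).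
rewrite -sum1_card; apply/eq_leq/eq_bigl => x; rewrite inE xpair_eqE.
by case: (x \in X).
Qed.

(** No color is below [0] or at least [2 ^ T - 1], so both end palettes are empty; [k] only supplies
    a constant class map. *)
Lemma valid_fresh P r T X (k : 'I_n) :
  n < 2 ^ T -> capped P r X -> valid X (Task P r T 0).
Proof.
move=> ltnT capX.
have no Q : Q = set0 -> class_capped Q r.-1 X.
  by move=> ->; exists (fun=> k) => j; apply: capped_no_color.
split=> //=; apply: no; apply/setP => j; rewrite !inE ?andbF //.
by have := ltn_ord j; lia.
Qed.

(** A split turns [2 ^ r.+1] into twice [2 ^ r], so the weight bound [K] persists and always bounds
    the number of tasks. *)
Lemma card_le_cost K T (st : seq task) X :
  1 < n -> n < 2 ^ T ->
  {in st, forall i, valid X i} ->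
  (forall u v, u \in X -> v \in X -> u < v ->
     has (fun i => c u v \in palette i) st) ->
  \sum_(i <- st) 2 ^ cap i <= K ->
  #|X| <= \prod_(i <- st) cost K T (cap i) (fuel i).
Proof.
move=> n1 ltnT; have n0 := ltnW n1.
pose vol st := \prod_(i <- st) cost K T (cap i) (fuel i).
have vol_gt0 s : 0 < vol s by apply: prodn_gt0 => i; apply: cost_gt0.
have vol_rem (i : task) (s : seq task) :
    i \in s -> vol s = cost K T (cap i) (fuel i) * vol (rem i s).
  by move=> si; rewrite /vol (big_rem i).
have sub_rem (i : task) (s : seq task) (Y Z : {set _}) :
    {in s, forall i, valid Y i} -> Z \subset Y ->
    {in rem i s, forall i, valid Z i}.
  move=> sY ZY j /mem_rem/sY; exact: valid_subset.
rewrite -/(vol st); have [m] := ubnP (vol st).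
elim: m => // m IH in st X * => /ltnSE vol_m stX cov wt.
have [X1|X1] := leqP #|X| 1; first exact: leq_trans X1 (vol_gt0 _).
have k0 : 'I_n by exact: Ordinal n0.
have K0 : 0 < K.
  have /card_gt1P[x [y [xX yX]]] := X1.
  rewrite -val_eqE neq_ltn => xy.
  have [i ist] : exists i, i \in st.
    by case/orP: xy => /cov => /(_ _ _)/hasP[]// i; exists i.
  apply: leq_trans wt; rewrite (big_rem i) //= addn_gt0 expn_gt0; lia.
have [/hasP[i ist /andP[]]|/hasPn done_or_fuel] :=
    boolP (has (fun i => (0 < cap i) && (fuel i == 0)) st).
  case: i ist => P [//|r] t a ist /= _ /eqP t0; rewrite {}t0 in ist.
  have [_ [f fP] [g gP]] := stX _ ist.
  rewrite /= addn0 in fP gP.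
  (* An exhausted search: its threshold splits the palette, and both halves start afresh with full
     fuel. *)
  pose st' := [:: Task (colors_lt P a) r T 0, Task (colors_ge P a) r T 0
    & rem (Task P r.+1 0 a) st].
  have volE : vol st = n ^ 2 * vol st'.
    by rewrite (vol_rem _ _ ist) /= /vol !big_cons /= mul1n -mulnn !mulnA.
  rewrite volE; apply: (@card_fibers _ _ f g) => j k.
  set Y := [set x in X | _].
  have YX : Y \subset X by apply/subsetP => x; rewrite inE => /andP[].
  apply: IH.
  - apply: leq_trans vol_m; rewrite volE -[ltnLHS]mul1n ltn_pmul2r //.
    by rewrite -{1}(exp1n 2) ltn_exp2r.
  - move=> l; rewrite !inE => /or3P[/eqP->|/eqP->|].
    + apply: valid_fresh => //; apply: capped_subset (fP j) => //.
      by apply/subsetP => x; rewrite !inE => /and3P[-> ->].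
    + apply: valid_fresh => //; apply: capped_subset (gP k) => //.
      by apply/subsetP => x; rewrite !inE => /and3P[-> _ ->].
    + exact: sub_rem stX YX l.
  - move=> u v /(subsetP YX) uX /(subsetP YX) vX uv.
    have /hasP[l lst Pl] := cov _ _ uX vX uv; rewrite /= !inE.
    have [lE|lne] := eqVneq l (Task P r.+1 0 a).
      by rewrite lE /= in Pl; rewrite Pl /=; case: leqP; rewrite ?orbT.
    do 2![apply/orP; right]; apply/hasP; exists l => //.
    move: lst; rewrite (perm_mem (perm_to_rem ist)) inE (negPf lne) //.
  - apply: leq_trans wt; rewrite !big_cons (big_rem _ ist) /= expnS; lia.
(* Passing to a neighborhood uses one unit of fuel, so induction gains the factor [4 * K + 1]; with
   cap 0 the neighborhood is empty. *)
have small i u : i \in st -> u \in X ->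
    #|after X i u| * (4 * K).+1 <= vol st /\
    #|before X i u| * (4 * K).+1 <= vol st.
  move=> ist uX; have vi := stX _ ist.
  have := done_or_fuel _ ist.
  case: i ist vi => P [|r] t a ist vi /=.
    move=> _; have [cap0 _ _] := vi.
    have -> : after X (Task P 0 t a) u = set0.
      apply/setP => v; rewrite !inE; apply/negP => /and4P[vX uv Pc _].
      by have := capped0_no_pair cap0 uX vX uv; rewrite Pc.
    have -> : before X (Task P 0 t a) u = set0.
      apply/setP => v; rewrite !inE; apply/negP => /and4P[vX uv Pc _].
      by have := capped0_no_pair cap0 vX uX uv; rewrite Pc.
    by rewrite cards0.
  case: t ist vi => [//|t] ist vi _.
  have go Y a' : Y \subset X -> valid Y (Task P r.+1 t a') ->
      #|Y| * (4 * K).+1 <= vol st.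
    move=> YX vY.
    pose st' := Task P r.+1 t a' :: rem (Task P r.+1 t.+1 a) st.
    have volE : vol st = vol st' * (4 * K).+1.
      rewrite (vol_rem _ _ ist) /= /vol !big_cons /= expnS; nia.
    rewrite volE leq_pmul2r //; apply: IH.
    - by apply: leq_trans vol_m; rewrite volE -[ltnLHS]muln1 ltn_pmul2l //; lia.
    - by move=> l; rewrite inE => /predU1P[-> //|]; apply: sub_rem stX YX l.
    - move=> x v /(subsetP YX) xX /(subsetP YX) vX xv.
      have /hasP[l lst Pl] := cov _ _ xX vX xv; rewrite /=.
      have [lE|lne] := eqVneq l (Task P r.+1 t.+1 a).
        by rewrite lE /= in Pl; rewrite Pl.
      apply/orP; right; apply/hasP; exists l => //.
      by move: lst; rewrite (perm_mem (perm_to_rem ist)) inE (negPf lne).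
    - by apply: leq_trans wt; rewrite big_cons (big_rem _ ist).
  split.
    by apply: go (after_subset _ _ _) _; apply: valid_after.
  by apply: go (before_subset _ _ _) _; apply: valid_before.
have sizeK : size st <= K.
  apply: leq_trans wt; rewrite -sum1_size; apply: leq_sum => i _.
  by rewrite expn_gt0.
have sum_le :
    (\sum_(i <- st) \sum_(u in X) (#|after X i u| + #|before X i u|)) *
    (4 * K).+1 <= K * (#|X| * (vol st).*2).
  rewrite big_distrl /=;
  apply: (@leq_trans (\sum_(i <- st) #|X| * (vol st).*2)).
    rewrite big_seq [leqRHS]big_seq; apply: leq_sum => i ist.
    rewrite big_distrl /= -sum_nat_const; apply: leq_sum => u uX.
    by rewrite mulnDl -addnn; have [? ?] := small _ _ ist uX; apply: leq_add.
  by rewrite big_const_seq count_predT iter_addn_0 mulnC leq_mul2r sizeK orbT.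
(* If [vol st < #|X|], counting pairs gives [vol st * (4 * K + 1) <= 4 * K * vol st], which is
   absurd. *)
have := card_pairs_le cov; have := card_pairs X.
move: sum_le; set A := \sum_(u in X) _; set B := \sum_(i <- st) _.
move=> sum_le XA AB; rewrite leqNgt; apply/negP => volX.
have : #|X| * (#|X|.-1 * (4 * K).+1) <= #|X| * (4 * K * vol st).
  rewrite mulnA XA; apply: (@leq_trans (B * (4 * K).+1).*2); last by lia.
  by rewrite -doubleMl leq_double leq_mul2r AB.
rewrite leq_pmul2l; last by lia.
have V0 := vol_gt0 st.
have: vol st * (4 * K).+1 <= #|X|.-1 * (4 * K).+1 by rewrite leq_mul2r; lia.
lia.
Qed.

End BinarySearch.

(** * An explicit power of [n] *)

Lemma exists_nonincreasing (N n s T : nat) (c : 'I_N -> 'I_N -> 'I_n) :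
  1 < n -> 1 < s -> n < 2 ^ T -> cost n (2 ^ (s - 2)) T (s - 2) T < N ->
  exists2 S : {set 'I_N}, #|S| = s & nonincreasing c S.
Proof.
move=> n1 s1 ltnT ltN; apply: contrapT => noS.
have capT : capped c [set: 'I_n] (s - 2) [set: 'I_N].
  move=> S _ incS _; rewrite leqNgt; apply/negP => ltS; apply: noS.
  (* A set with more than [s - 1] vertices is trimmed to exactly [s]. *)
  exists [set x in take s (enum S)].
    rewrite cardsE; have /card_uniqP-> := take_uniq s (enum_uniq (mem S)).
    by rewrite size_takel -?cardE //; apply: leq_trans ltS; lia.
  move=> u v w; rewrite !inE => /mem_take + /mem_take + /mem_take.
  by rewrite !mem_enum; apply: incS.
have fresh := valid_fresh (Ordinal (ltnW n1)) ltnT capT.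
have := @card_le_cost N n c (2 ^ (s - 2)) T [:: Task setT (s - 2) T 0] setT
  n1 ltnT.
rewrite cardsT card_ord !big_cons !big_nil addn0 muln1 /= => bound.
suff: N <= cost n (2 ^ (s - 2)) T (s - 2) T by lia.
apply: bound => // [i|u v _ _ _]; first by rewrite inE => /eqP->.
by rewrite inE.
Qed.

Lemma cost_lt_expn (n r : nat) : 1 < n ->
  cost n (2 ^ r) (trunc_log 2 n).+1 r (trunc_log 2 n).+1 <
    n ^ ((2 * r + 8) * 2 ^ r).
Proof.
move=> n1; set T := (trunc_log 2 n).+1; set K := 2 ^ r.
have K0 : 0 < K by rewrite expn_gt0.
set E := (4 * K).+1 ^ T * n ^ 2.
have E1 : 1 < E.
  apply: (@leq_trans (n ^ 2)); last by rewrite leq_pmull ?expn_gt0.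
  by rewrite -{1}(exp1n 2) ltn_exp2r.
(* The recursion is [cost (q + 1) = E * cost q ^ 2], so multiplying by [E] turns it into pure
   squaring. *)
have costE q : cost n K T q T * E = E ^ (2 ^ q).
  elim: q => [|q IH] /=; first by rewrite mul1n.
  by rewrite -/E (expnS 2 q) (mulnC 2) expnM -IH expnMn mulnC mulnA mulnn mulnC.
have leT : 2 ^ T <= n ^ 2.
  by rewrite (expnS 2) -mulnn leq_mul // trunc_logP //; lia.
(* From [4 * K + 1 <= 2 ^ (r + 3)] and [2 ^ T <= n ^ 2]. *)
have leE : E <= n ^ (2 * r + 8).
  have -> : 2 * r + 8 = 2 * (r + 3) + 2 by lia.
  rewrite expnD leq_mul2r; apply/orP; right.
  rewrite expnM; apply: (@leq_trans ((2 ^ (r + 3)) ^ T)).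
    by rewrite leq_exp2r // expnD -/K; lia.
  by rewrite -expnM mulnC expnM leq_exp2r //; lia.
rewrite expnM; apply: (@leq_trans (E ^ (2 ^ r))); last first.
  by rewrite leq_exp2r // expn_gt0.
by rewrite -costE -[ltnLHS]muln1 ltn_pmul2l // cost_gt0 //; lia.
Qed.

Lemma exponent_le (s : nat) : 2 < s ->
  (2 * (s - 2) + 8) * 2 ^ (s - 2) <= 5 ^ s * s`!.
Proof.
move=> s2; have -> : s = (s - 2).+2 by lia.
set r := s - 2; have r1 : 0 < r by rewrite /r; lia.
have les : r.+2 <= (r.+2)`! by rewrite factS leq_pmulr ?fact_gt0.
have le25 : 2 ^ r <= 5 ^ r by rewrite leq_exp2r.
have : 2 ^ r * r.+2 <= 5 ^ r * (r.+2)`! by apply: leq_mul.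
rewrite (_ : r.+2 - 2 = r) ?expnS; last by lia.
set A := 2 ^ r; set B := 5 ^ r * _ => AB.
have -> : 5 * (5 * 5 ^ r) * (r.+2)`! = 25 * B by rewrite /B; lia.
have : (2 * r + 8) * A <= 4 * (A * r.+2) by nia.
lia.
Qed.

Lemma forces_noninc_expn (s n : nat) : 2 < s -> 1 < n ->
  forces_noninc s n (n ^ (5 ^ s * s`!)).
Proof.
move=> s2 n1 kappa chi [kappa_mono chiE].
(* Colors are replaced by their indices; the default never occurs for [u < v]. *)
pose c u v := odflt (Ordinal (ltnW n1)) [pick i | chi u v == kappa i].
have cE (u v : 'I__) : u < v -> chi u v = kappa (c u v).
  move=> uv; rewrite /c; case: pickP => [i /eqP //|none].
  by have [i Ei] := chiE u v uv; have := none i; rewrite Ei eqxx.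
have kappa_le (i j : 'I_n) : i <= j -> (kappa i <= kappa j)%R.
  rewrite leq_eqVlt => /predU1P[/val_inj-> //|ij].
  exact: ltW (kappa_mono _ _ ij).
have [||||S cardS incS] := @exists_nonincreasing _ n s (trunc_log 2 n).+1 c.
- by [].
- by lia.
- exact: trunc_log_ltn.
- apply: leq_trans (cost_lt_expn (s - 2) n1) _.
  by rewrite leq_exp2l // exponent_le.
exists S; split=> // u v w uS vS wS uv vw.
rewrite /noninc_triple !cE //; last exact: ltn_trans uv vw.
have [[-> ?]|[? <-]] := incS u v w uS vS wS uv vw.
  by left; split=> //; apply: kappa_le.
by right; split=> //; apply: kappa_le.
Qed.

Lemma exists_is_f (s n M : nat) : forces_noninc s n M ->
  exists2 N, is_f s n N & N <= M.
Proof.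
move=> forceM.
have exM : exists N, `[< forces_noninc s n N >] by exists M; apply/asboolP.
case: (ex_minnP exM) => N /asboolP forceN minN; exists N.
  by split=> // K forceK; apply: minN; apply/asboolP.
by apply: minN; apply/asboolP.
Qed.

(** * The bound in real exponents *)

Local Open Scope ring_scope.

Lemma powR2_log2 (R : realType) (x : R) : 0 < x -> 2 `^ (log2 x) = x.
Proof.
move=> x0; have ln2 : ln (2 : R) != 0.
  by rewrite gt_eqF // ln_gt0 // ltr1n.
by rewrite /powR pnatr_eq0 /= /log2 divfK // lnK.
Qed.

Lemma log2_ge1 (R : realType) (x : R) : 2 <= x -> 1 <= log2 x.
Proof.
move=> x2; have ln2 : 0 < ln (2 : R) by rewrite ln_gt0 // ltr1n.
rewrite /log2 ler_pdivlMr // mul1r ler_ln ?posrE //.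
exact: lt_le_trans x2.
Qed.

Theorem theorem2p3 (R : realType) (s n : nat) (hs : (3 <= s)%N)
    (hn : (2 <= n)%N) :
  exists N : nat, is_f s n N /\
    (N%:R : R) <= 2 `^ (5 ^+ s * (s`!)%:R * (log2 (n%:R : R)) ^+ (s - 2)).
Proof.
have [N fN leN] := exists_is_f (forces_noninc_expn hs hn).
exists N; split=> //.
have n2 : (2 : R) <= n%:R by rewrite ler_nat.
have n0 : (0 : R) < n%:R by apply: lt_le_trans n2.
have log1 := log2_ge1 n2.
apply: (@le_trans _ _ ((n ^ (5 ^ s * s`!))%:R)); first by rewrite ler_nat.
rewrite natrX -{1}(powR2_log2 n0) -(powR_mulrn _ (powR_ge0 _ _)) -powRrM.
apply: ler_powR; first by rewrite ler1n.
rewrite natrM natrX mulrC; apply: ler_wpM2l.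
  by rewrite mulr_ge0 // exprn_ge0.
(* Since [log2 n >= 1] and [s - 2 >= 1], the power of the logarithm is at least the logarithm. *)
by apply: ler_eXnr => //; rewrite subn_gt0.
Qed.
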